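(* Let $n>3$ be an odd integer and let $G$ be a graph on $n$ vertices with a unique vertex $v$ of degree $n-1$ and all other vertices of degree $r_2$, where $r_2\in\{1,2,3,n-3\}$. Let $\Gamma$ be any abelian group with $|\Gamma|=n$ and identity element $e$, and let $l:V(G)\to\Gamma$ be a bijection. If $l(v)\neq e$, then $l$ is not a $\Gamma$-distance magic labeling of $G$.
   Context: All graphs are finite and simple; all groups are finite additive abelian groups. $N_G(u)$ is the set of vertices adjacent to $u$ in $G$, and the degree of $u$ is $|N_G(u)|$. For a graph $G$ and an abelian group $\Gamma$ with $|V(G)|=|\Gamma|$, a $\Gamma$-distance magic labeling of $G$ is a bijection $l:V(G)\to\Gamma$ for which there is an element $\mu_0\in\Gamma$ such that $w_G(u)=\sum_{x\in N_G(u)}l(x)=\mu_0$ for every $u\in V(G)$. *)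

(* Defs.v *)
From HB Require Import structures.
From mathcomp Require Import all_boot all_algebra.
Set Implicit Arguments.
Unset Strict Implicit.
Unset Printing Implicit Defensive.

(* A finite simple graph is a finite vertex type V together with a symmetric
   and irreflexive adjacency relation adj : rel V. Finite additive abelian
   groups are finZmodTypes, with identity element 0. *)

Definition is_simple_graph (V : finType) (adj : rel V) : Prop :=
  symmetric adj /\ irreflexive adj.

Definition neighbors (V : finType) (adj : rel V) (u : V) : {set V} :=
  [set x | adj u x].

Definition degree (V : finType) (adj : rel V) (u : V) : nat :=
  #|neighbors adj u|.

Definition weight (V : finType) (adj : rel V) (Gamma : finZmodType)
    (l : V -> Gamma) (u : V) : Gamma :=
  (\sum_(x in neighbors adj u) l x)%R.

(* The condition #|V| = #|Gamma| is implied by the bijectivity of l. *)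
Definition is_distance_magic (V : finType) (adj : rel V) (Gamma : finZmodType)
    (l : V -> Gamma) : Prop :=
  bijective l /\ exists mu0 : Gamma, forall u : V, weight adj l u = mu0.

(* Main.v *)
Require Import Defs.
From HB Require Import structures.
From mathcomp Require Import all_boot all_algebra.

(** Let g = l(v). As n is odd, the elements of Gamma sum to 0 and Gamma has no
    element of order 2. Since v is adjacent to every other vertex, its weight is
    -g, so mu0 = -g. Counting sum_u w(u) by vertices gives n mu0 = 0, and counting
    it by edges gives (n-1) g + r2 (-g); hence (r2 + 1) g = 0. For r2 = 1, 3, n-3
    this says 2g = 0 or 4g = 0, so g = 0. For r2 = 2 it says 3g = 0; but then a
    vertex u <> v has neighbors v and x with g + l(x) = -g, so l(x) = -2g = g,
    contradicting injectivity of l. *)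

Set Implicit Arguments.
Unset Strict Implicit.
Unset Printing Implicit Defensive.

Import GRing.Theory.
Local Open Scope ring_scope.

(** Translation by [x] permutes the group, so the sum of all elements absorbs [#|Gamma|] copies of
    [x]. *)
Lemma mulrn_card (Gamma : finZmodType) (x : Gamma) : x *+ #|Gamma| = 0.
Proof.
apply: (@addrI _ (\sum_(y : Gamma) y)); rewrite addr0.
rewrite [RHS](reindex_inj (addIr x)) big_split /=.
by rewrite sumr_const.
Qed.

Lemma odd_card_double_eq0 (Gamma : finZmodType) (x : Gamma) :
  odd #|Gamma| -> x *+ 2 = 0 -> x = 0.
Proof.
move=> oddG x2; have := mulrn_card x.
by rewrite -(odd_double_half #|Gamma|) oddG mulrS -mul2n mulrnA x2 mul0rn addr0.
Qed.

(** Negation permutes the group, so the sum is its own opposite and its double vanishes. *)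
Lemma odd_card_sum_eq0 (Gamma : finZmodType) :
  odd #|Gamma| -> \sum_(x : Gamma) x = 0.
Proof.
move=> oddG; apply: odd_card_double_eq0 => //; rewrite mulr2n.
by rewrite {1}(reindex_inj oppr_inj) sumrN addNr.
Qed.

Lemma sum_weight (V : finType) (adj : rel V) (Gamma : finZmodType)
    (l : V -> Gamma) : symmetric adj ->
  \sum_u weight adj l u = \sum_x l x *+ degree adj x.
Proof.
move=> sym; rewrite /weight (exchange_big_dep xpredT) //=.
apply: eq_bigr => x _; rewrite sumr_const; congr (_ *+ _).
by apply: eq_card => u; rewrite [RHS]inE sym; apply: in_set.
Qed.

Lemma neighbors_dominating (V : finType) (adj : rel V) (v : V) :
  irreflexive adj -> degree adj v = (#|V| - 1)%N ->
  neighbors adj v = [set~ v].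
Proof.
move=> irr hv; apply/eqP; rewrite eqEcard; apply/andP; split.
  by apply/subsetP => x; rewrite !inE; apply: contraTneq => ->; rewrite irr.
by rewrite cardsC1 -subn1 -hv leqnn.
Qed.

Section DominatingVertex.

Variables (V : finType) (adj : rel V) (Gamma : finZmodType) (l : V -> Gamma).
Variables (v : V) (r : nat) (mu0 : Gamma).
Hypotheses (sym : symmetric adj) (irr : irreflexive adj).
Hypotheses (oddG : odd #|Gamma|) (bij_l : bijective l).
Hypothesis (hv : degree adj v = (#|V| - 1)%N).
Hypothesis (hdeg : forall u, u <> v -> degree adj u = r).
Hypothesis (magic : forall u, weight adj l u = mu0).

Lemma sum_other_labels : \sum_(x | x != v) l x = - l v.
Proof.
have := odd_card_sum_eq0 oddG.
rewrite (reindex l) /=; last exact: onW_bij.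
by rewrite (bigD1 v) /= 1?addrC => // /eqP; rewrite addr_eq0 => /eqP.
Qed.

Lemma magic_constantE : mu0 = - l v.
Proof.
rewrite -(magic v) /weight neighbors_dominating // -sum_other_labels.
by apply: eq_bigl => x; rewrite !inE.
Qed.

Lemma label_mulrn_degreeS : l v *+ r.+1 = 0.
Proof.
have cardE : #|V| = #|Gamma| := bij_eq_card bij_l.
have := sum_weight l sym.
rewrite (eq_bigr (fun=> mu0)) // sumr_const cardE mulrn_card (bigD1 v) //=.
rewrite (eq_bigr (fun x => l x *+ r)) => [|x /eqP xv]; last by rewrite hdeg.
rewrite sumrMnl sum_other_labels hv cardE mulNrn => /esym/eqP.
(* By [eq_r], [r] copies of [l v] amount to [#|Gamma| - 1] copies; one more makes [#|Gamma|] of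
   them. *)
rewrite subr_eq0 => /eqP eq_r; rewrite mulrS -eq_r -mulrS subn1 prednK.
  exact: mulrn_card.
exact: odd_gt0.
Qed.

Lemma degree2_label_eq0 (u : V) : u != v -> r = 2 -> l v = 0.
Proof.
move=> uv r2.
have vu : v \in neighbors adj u.
  have /setP/(_ u) := neighbors_dominating irr hv; by rewrite !inE sym uv.
have : #|neighbors adj u :\ v| == 1.
  have := hdeg (elimN eqP uv); rewrite /degree (cardsD1 v) vu r2.
  by rewrite add1n => -[->].
case/cards1P => x Nx.
have : x != v by have : x \in [set x] := set11 x; rewrite -Nx !inE => /andP[].
have := magic u; rewrite /weight magic_constantE (big_setD1 v) //= Nx big_set1.
move=> wu; have := label_mulrn_degreeS; rewrite r2 => g3.
(* The goal still carries the premise [x != v], which becomes absurd once [x] is replaced by [v]. *)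
have /(bij_inj bij_l) -> : l x = l v; last by rewrite eqxx.
apply: (@addrI _ (l v)); rewrite wu; apply/eqP.
by rewrite eq_sym -addr_eq0 -mulr2n -mulrSr g3.
Qed.

End DominatingVertex.

Local Close Scope ring_scope.

Theorem mainTheorem9 (n : nat) (hn3 : 3 < n) (hodd : odd n)
    (V : finType) (adj : rel V) (hG : is_simple_graph adj) (hV : #|V| = n)
    (v : V) (hv : degree adj v = n - 1)
    (hv_unique : forall u : V, degree adj u = n - 1 -> u = v)
    (r2 : nat) (hr2 : r2 \in [:: 1; 2; 3; n - 3])
    (hdeg : forall u : V, u <> v -> degree adj u = r2)
    (Gamma : finZmodType) (hGamma : #|Gamma| = n)
    (l : V -> Gamma) (hl : bijective l) (hlv : l v <> 0%R) :
  ~ is_distance_magic adj l.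
Proof.
case=> _ [mu0 magic]; case: hG => sym irr; apply: hlv.
have oddG : odd #|Gamma| by rewrite hGamma.
rewrite -hV in hv.
have g0 := @odd_card_double_eq0 _ (l v) oddG.
have gr := label_mulrn_degreeS sym oddG hl hv hdeg magic.
move: hr2; rewrite !inE => /or4P[] /eqP r2E.
- by apply: g0; rewrite r2E in gr.
(* For [r2 = 2] a vertex other than [v] is needed; [n > 3] provides one. *)
- have /card_gt0P[u] : 0 < #|[set~ v]| by rewrite cardsC1 hV; case: (n) hn3 => [|[]].
  by rewrite !inE => uv; apply: (degree2_label_eq0 sym irr oddG hl hv hdeg magic uv).
(* Here [gr] says [l v *+ 4 = 0], and 4 is halved twice. *)
- by do 2 apply: odd_card_double_eq0 => //; rewrite -mulrnA; rewrite r2E in gr.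
- apply: g0; have := mulrn_card (l v); rewrite hGamma.
  (* Both [n] and [r2.+1 = n - 2] annihilate [l v], hence so does their difference 2. *)
  have -> : n = r2.+1 + 2 by rewrite r2E addSn -addnS subnK // ltnW.
  by rewrite mulrnDr gr add0r.
Qed.
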